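(* Let $\rho\geq1$ be an integer, let $\Lambda=(\lambda_1,\ldots,\lambda_\rho)$ be an integer sequence with $1\leq\lambda_1\leq\cdots\leq\lambda_\rho$, put $\lambda=\lambda_1+\cdots+\lambda_\rho$, let $T=(t_{r,i})_{1\leq r\leq\rho,\,1\leq i\leq\lambda_r}$ be a tuple of positive integer parameters, and let $Z=(z_{r,i})_{1\leq r\leq\rho,\,1\leq i\leq\lambda_r}$ be a tuple of variables. Let $b\geq 2$, $\ell\geq 1$, and $n\geq 1$ be integers. Then the identity $$\Omega_{b,T}^\Lambda(n\cdot b^\ell+j;Z)=\Omega_{b,T}^\Lambda(n;Z^{T^\ell})\cdot\Omega_{b,T}^\Lambda(j;Z)$$ holds, in the case $b\leq\lambda$, for all integers $j$ with $$(\lambda-b+1)\frac{b^\ell-1}{b-1}\leq j\leq b^\ell-1.$$ When $b>\lambda$, the identity holds for all integers $j$ with $0\leq j\leq b^\ell-1$.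
   Context: The polynomials $\Omega_{b,T}^\Lambda(n;Z)$ in the $\lambda$ variables $z_{r,i}$ are defined by the generating function (a formal power series identity in $q$) $$\sum_{n=0}^\infty\Omega_{b,T}^\Lambda(n;Z)q^n=\prod_{j=0}^\infty\prod_{r=1}^\rho\left(1+z_{r,1}^{t_{r,1}^j}q^{b^j}+z_{r,2}^{t_{r,2}^j}q^{2\cdot b^j}+\cdots+z_{r,\lambda_r}^{t_{r,\lambda_r}^j}q^{\lambda_r\cdot b^j}\right).$$ $Z^{T^\ell}$ denotes the tuple $(z_{r,i}^{t_{r,i}^\ell})_{1\leq r\leq\rho,\,1\leq i\leq\lambda_r}$, i.e., $\Omega_{b,T}^\Lambda(n;Z^{T^\ell})$ is obtained from $\Omega_{b,T}^\Lambda(n;Z)$ by replacing each variable $z_{r,i}$ by $z_{r,i}^{t_{r,i}^\ell}$. *)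

(* Defs.v *)
From HB Require Import structures.
From mathcomp Require Import all_boot all_order all_algebra.
From mathcomp Require Import mpoly.

Set Implicit Arguments.
Unset Strict Implicit.
Unset Printing Implicit Defensive.

Import GRing.Theory.
Local Open Scope ring_scope.

(* The formal power series identity \sum_n (a n) q^n = \prod_(j >= 0) F j,
   where the infinite product is the q-adic limit of its partial products:
   every coefficient of the partial products is eventually constant, with
   value the corresponding coefficient of the series on the left. *)
Definition fps_eq_infprod (R : nzRingType) (a : nat -> R)
    (F : nat -> {poly R}) : Prop :=
  forall n, exists N0, forall N, (N0 <= N)%N -> (\prod_(j < N) F j)`_n = a n.

Section Omega.

Variables (rho : nat) (lam : 'I_rho -> nat).

(* Integer polynomials in lam_1 + ... + lam_rho variables. Both indices of
   z_{r,i} are shifted to start at 0 (i : 'I_(lam r) stands for i + 1), and the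
   pairs (r, i) are numbered through tagnat, whose inverse numbering is
   k |-> (tagnat.sig1 k, tagnat.sig2 k). *)
Local Notation zpoly := {mpoly int[\sum_(r < rho) lam r]}.

Definition zvar (r : 'I_rho) (i : 'I_(lam r)) : zpoly := 'X_(tagnat.Rank r i).

Variables (b : nat) (t : forall r : 'I_rho, 'I_(lam r) -> nat).

Definition Omega_factor (j : nat) : {poly zpoly} :=
  \prod_(r < rho)
    (1 + \sum_(i < lam r) zvar i ^+ (t i ^ j) *: 'X^(i.+1 * b ^ j)).

Definition is_Omega (Om : nat -> zpoly) : Prop :=
  fps_eq_infprod Om Omega_factor.

Definition Zpow (l : nat) : (\sum_(r < rho) lam r).-tuple zpoly :=
  [tuple zvar (tagnat.sig2 k) ^+ (t (tagnat.sig2 k) ^ l)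
    | k < \sum_(r < rho) lam r].

Definition subst_Zpow (l : nat) (p : zpoly) : zpoly := comp_mpoly (Zpow l) p.

Lemma subst_Zpow_zvar (l : nat) (r : 'I_rho) (i : 'I_(lam r)) :
  subst_Zpow l (zvar i) = zvar i ^+ (t i ^ l).
Proof.
rewrite /subst_Zpow /zvar comp_mpolyXU -tnth_nth tnth_mktuple /zvar.
rewrite tagnat.sig2K; congr (_ ^+ (_ ^ _)).
have E : tagnat.sig (tagnat.Rank r i) = Tagged (fun r => 'I_(lam r)) i.
  by rewrite /tagnat.Rank tagnat.rankK.
by rewrite /tagnat.sig2 /tagnat.sig1 E.
Qed.

Lemma Omega_uniq (Om1 Om2 : nat -> zpoly) :
  is_Omega Om1 -> is_Omega Om2 -> Om1 =1 Om2.
Proof.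
move=> h1 h2 n; have [N1 e1] := h1 n; have [N2 e2] := h2 n.
by rewrite -(e1 (maxn N1 N2)) ?leq_maxl // -(e2 (maxn N1 N2)) ?leq_maxr.
Qed.

Lemma Omega_factor_eq1 (n j : nat) :
  (1 < b)%N -> (n <= j)%N -> exists G, Omega_factor j = 1 + G * 'X^(n.+1).
Proof.
move=> b1 nj; rewrite /Omega_factor.
apply: (big_ind (fun p : {poly zpoly} => exists G, p = 1 + G * 'X^(n.+1)))
  => [|_ _ [G ->] [H ->]|r _].
- by exists 0; rewrite mul0r addr0.
- exists (G + H + G * 'X^(n.+1) * H).
  by rewrite mulrDl mul1r mulrDr mulr1 !mulrDl mulrA -!addrA; congr (1 + _);
     rewrite addrCA.
- exists (\sum_(i < lam r)
    zvar i ^+ (t i ^ j) *: 'X^(i.+1 * b ^ j - n.+1)).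
  rewrite mulr_suml; congr (_ + _); apply: eq_bigr => i _.
  rewrite -scalerAl -exprD subnK // mulSn.
  exact: leq_trans (leq_ltn_trans nj (ltn_expl j b1)) (leq_addr _ _).
Qed.

Lemma Omega_ex : (1 < b)%N -> exists Om, is_Omega Om.
Proof.
move=> b1; exists (fun n => (\prod_(j < n) Omega_factor j)`_n) => n.
exists n => N /subnKC <-; elim: (N - n)%N => [|m IH]; first by rewrite addn0.
rewrite addnS big_ord_recr /=.
have [G ->] := Omega_factor_eq1 b1 (leq_addr m n).
by rewrite mulrDr mulr1 mulrA coefD IH coefMXn ltnSn addr0.
Qed.

End Omega.

(* Main.v *)
Require Import Defs.
From mathcomp Require Import all_boot all_order all_algebra.
From mathcomp Require Import mpoly.

(** Since F_(l+i)(q; Z) = F_i(q^(b^l); Z^(T^l)), the generating product splits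
    as P_l(q) * sum_m Omega(m; Z^(T^l)) q^(m b^l), where P_l is the product of
    the first l factors, of degree at most lambda (b^l - 1)/(b - 1). For
    j < b^l, the coefficient of q^(n b^l + j) gets a contribution from the
    coefficients of P_l of index j + k b^l only, and those with k > 0 vanish as
    soon as deg P_l < b^l + j. The case n = 0 identifies the coefficient of
    index j of P_l with Omega(j; Z). *)

Section Splitting.

Import GRing.Theory.
Local Open Scope ring_scope.

Variables (rho : nat) (lam : 'I_rho -> nat).
Variables (t : forall r : 'I_rho, 'I_(lam r) -> nat) (b : nat).

Local Notation zpoly := {mpoly int[\sum_(r < rho) lam r]}.
Local Notation lambda := (\sum_(r < rho) lam r)%N.
Local Notation F := (Omega_factor b t).

(** [map_poly] carries out Z -> Z^(T^l) on the coefficients and the composition carries out q ->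
    q^(b^l); exponents agree since t^l t^i = t^(l+i) and b^l b^i = b^(l+i). *)
Lemma Omega_factor_shift (l i : nat) :
  F (l + i) = map_poly (comp_mpoly (Zpow t l)) (F i) \Po 'X^(b ^ l).
Proof.
rewrite /Omega_factor !rmorph_prod; apply: eq_bigr => r _.
rewrite !rmorphD !rmorph1 !rmorph_sum; congr (_ + _).
apply: eq_bigr => k _.
rewrite /= map_polyZ map_polyXn comp_polyZ comp_Xn_poly -exprM rmorphXn.
rewrite /= -/(subst_Zpow t l (zvar k)) subst_Zpow_zvar -exprM -expnD.
by rewrite mulnCA -expnD.
Qed.

Lemma size_Omega_factor (i : nat) : (size (F i) <= (lambda * b ^ i).+1)%N.
Proof.
rewrite /Omega_factor big_distrl /=.
apply: (big_rec2 (fun (p : {poly zpoly}) m => size p <= m.+1)%N).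
  by rewrite size_poly1.
move=> r p m _ hp; apply: leq_trans (size_polyMleq _ _) _.
suff hq : (size (1 + \sum_(k < lam r) zvar k ^+ (t r k ^ i)
    *: 'X^(k.+1 * b ^ i) : {poly zpoly})%R <= (lam r * b ^ i).+1)%N.
  by have := leq_add hq hp; rewrite addSn addnS; case: (_ + _)%N.
apply: leq_trans (size_polyD _ _) _; rewrite geq_max size_poly1 /=.
apply: leq_trans (size_sum _ _ _) _; apply/bigmax_leqP => k _.
by apply: leq_trans (size_scale_leq _ _) _; rewrite size_polyXn ltnS leq_mul.
Qed.

Lemma size_prod_Omega_factor (l : nat) :
  (size (\prod_(i < l) F i)%R <= (lambda * \sum_(i < l) b ^ i).+1)%N.
Proof.
rewrite big_distrr /=.
apply: (big_rec2 (fun (p : {poly zpoly}) m => size p <= m.+1)%N).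
  by rewrite size_poly1.
move=> i p m _ hp; apply: leq_trans (size_polyMleq _ _) _.
have := leq_add (size_Omega_factor i) hp.
by rewrite addSn addnS; case: (_ + _)%N.
Qed.

Lemma coef0_Omega_factor (i : nat) : (0 < b)%N -> (F i)`_0 = 1.
Proof.
move=> b0; rewrite /Omega_factor coef0_prod; apply: big1 => r _.
rewrite coefD coef1 coef_sum -[RHS]addr0; congr (_ + _); apply: big1 => k _.
by rewrite coefZ coefXn eq_sym muln_eq0 /= expn_eq0 gtn_eqF ?mulr0.
Qed.

Variable Om : nat -> zpoly.
Hypotheses (b1 : (1 < b)%N) (OmP : is_Omega b t Om).

Lemma Omega0 : Om 0 = 1.
Proof.
have [N /(_ N (leqnn N)) <-] := OmP 0.
by rewrite coef0_prod; apply: big1 => i _; rewrite coef0_Omega_factor // ltnW.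
Qed.

Lemma Omega_split (l n j : nat) :
  (j < b ^ l)%N -> (lambda * \sum_(i < l) b ^ i < b ^ l + j)%N ->
  Om (n * b ^ l + j) = (\prod_(i < l) F i)`_j * subst_Zpow t l (Om n).
Proof.
move=> jlt deg; have [N1 e1] := OmP (n * b ^ l + j)%N; have [N2 e2] := OmP n.
(* Truncating at l + M factors leaves M factors after the shift, enough to stabilise both
   coefficients. *)
pose M := maxn N1 N2.
rewrite -(e1 (l + M)%N) ?(leq_trans (leq_maxl _ _) (leq_addl _ _)) //.
rewrite -(e2 M) ?leq_maxr // big_split_ord /=.
under [X in _ * X]eq_bigr => i _ do rewrite Omega_factor_shift.
rewrite -rmorph_prod -rmorph_prod /=.
set P := \prod_(i < l) _; set Q := \prod_(i < M) _.
have bl0 : (0 < b ^ l)%N by rewrite expn_gt0 ltnW.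
have jN : (j < (n * b ^ l + j).+1)%N by rewrite ltnS leq_addl.
(* In the convolution, index j of [P] meets exponent n b^l, which gives the main term. *)
rewrite coefM (bigD1 (Ordinal jN)) //= addnK coef_comp_poly_Xn // dvdn_mull //.
rewrite mulnK // coef_map -[RHS]addr0; congr (_ + _).
(* Any other index i either leaves an exponent not divisible by b^l, absent from the composed
   series, or is i = j + k b^l with k > 0, beyond the degree of [P]. *)
apply: big1 => -[i /= iN] ij.
rewrite coef_comp_poly_Xn //; case: ifP => [dv|_]; last by rewrite mulr0.
rewrite nth_default ?mul0r //; apply: leq_trans (size_prod_Omega_factor l) _.
apply: leq_trans deg _.
have ij' : i = j %[mod b ^ l].
  by apply/eqP; rewrite eq_sym -(modnMDl n) eqn_mod_dvd // -ltnS.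
rewrite (divn_eq i (b ^ l)) ij' (modn_small jlt) leq_add2r leq_pmull //.
(* A zero quotient would force i = j, as i and j have the same remainder. *)
rewrite lt0n; apply: contraNneq ij => q0; apply/eqP/val_inj => /=.
by rewrite (divn_eq i (b ^ l)) q0 ij' modn_small.
Qed.

Lemma Omega_mul (l n j : nat) :
  (j < b ^ l)%N -> (lambda * \sum_(i < l) b ^ i < b ^ l + j)%N ->
  Om (n * b ^ l + j) = subst_Zpow t l (Om n) * Om j.
Proof.
move=> jlt deg; rewrite Omega_split // mulrC; congr (_ * _).
by have := Omega_split l 0 j jlt deg; rewrite Omega0 /subst_Zpow rmorph1 mulr1.
Qed.

End Splitting.

Theorem theorem7p2 (rho : nat) (lam : 'I_rho -> nat)
    (t : forall r : 'I_rho, 'I_(lam r) -> nat)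
    (b l n : nat) (Om : nat -> {mpoly int[\sum_(r < rho) lam r]}) :
  (1 <= rho)%N ->
  (forall r, (1 <= lam r)%N) ->
  (forall r s : 'I_rho, (r <= s)%N -> (lam r <= lam s)%N) ->
  (forall (r : 'I_rho) (i : 'I_(lam r)), (1 <= t r i)%N) ->
  (2 <= b)%N -> (1 <= l)%N -> (1 <= n)%N ->
  is_Omega b t Om ->
  let lambda := (\sum_(r < rho) lam r)%N in
  ((b <= lambda)%N ->
    forall j : nat,
      ((lambda - b + 1) * ((b ^ l - 1) %/ (b - 1)) <= j <= b ^ l - 1)%N ->
      Om (n * b ^ l + j)%N = (subst_Zpow t l (Om n) * Om j)%R)
  /\
  ((lambda < b)%N ->
    forall j : nat,
      (0 <= j <= b ^ l - 1)%N ->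
      Om (n * b ^ l + j)%N = (subst_Zpow t l (Om n) * Om j)%R).
Proof.
move=> _ _ _ _ b2 _ _ OmP lambda.
have bl0 : (0 < b ^ l)%N by rewrite expn_gt0 ltnW.
have geom : (b ^ l = (b - 1) * (\sum_(i < l) b ^ i) + 1)%N.
  by rewrite subn1 -predn_exp addn1 prednK.
have lt_bl j : (j <= b ^ l - 1)%N -> (j < b ^ l)%N.
  by move=> jle; rewrite (leq_ltn_trans jle) // subn1 prednK.
split=> lamb j /andP[jge /lt_bl jlt]; apply: Omega_mul => //.
(* With S the geometric sum, b^l = (b-1)S + 1 and the division is exact. Then (b-1)S + (lambda-b+1)S
   = lambda S, where b <= lambda makes the truncated subtraction exact. *)
- move: jge; rewrite {1}geom addnK mulKn ?subn_gt0 // => jge.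
  rewrite geom addn1 addSn ltnS; apply: leq_trans (leq_add (leqnn _) jge).
  by rewrite -mulnDl addn1 addnS -addSn subn1 prednK ?subnKC // ltnW.
(* Here lambda <= b-1, so lambda S <= (b-1)S already, whatever j is. *)
- rewrite geom addn1 addSn ltnS; apply: leq_trans (leq_addr _ _).
  by rewrite leq_mul2r -ltnS subn1 prednK ?lamb ?orbT // ltnW.
Qed.
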